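(* Let $N\ge 72$ be an integer and let $B_{\bar N}$ be the sequence defined by $B_{\bar N}(n)=0$ for all integers $n\le 0$, $B_{\bar N}(n)=n$ for $1\le n\le N$, and, for $n>N$, \[B_{\bar N}(n)=B_{\bar N}\bigl(n-B_{\bar N}(n-1)\bigr)+B_{\bar N}\bigl(n-B_{\bar N}(n-2)\bigr)+B_{\bar N}\bigl(n-B_{\bar N}(n-3)\bigr),\] where $B_{\bar N}(n)$ is defined only if all previous terms are defined and each index $n-B_{\bar N}(n-i)$ ($i=1,2,3$) is at most $n-1$ (indices $\le 0$ are allowed and give value $0$). Define \[\nu=\begin{cases}-1&N\equiv0\pmod 7\\-2&N\equiv1\pmod 7\\-2&N\equiv2\pmod 7\\-2&N\equiv3\pmod 7\\2&N\equiv4\pmod 7\\1&N\equiv5\pmod 7\\0&N\equiv6\pmod 7.\end{cases}\] Then for every integer $n$ with $N+67\le n\le 2N+\nu$, writing $n=N+7k+r$ with $k$ a positive integer and $0\le r\le 6$, the term $B_{\bar N}(n)$ is defined and \[B_{\bar N}(N+7k)=7k+2,\quad B_{\bar N}(N+7k+1)=N+7k+2,\quad B_{\bar N}(N+7k+2)=N+7k+4,\quad B_{\bar N}(N+7k+3)=7,\] \[B_{\bar N}(N+7k+4)=2N+2k+45,\quad B_{\bar N}(N+7k+5)=2N+k-7,\quad B_{\bar N}(N+7k+6)=N-2.\] Moreover: - if $N\equiv0\pmod7$ and $N\ge196$, then $B_{\bar N}$ ends after $2N+27$ terms; - if $N\equiv1\pmod7$ and $N\ge2087$, then $B_{\bar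 N}$ ends after $2N+254$ terms; - if $N\equiv2\pmod7$ and $N\ge3201$, then $B_{\bar N}$ ends after $2N+524$ terms; - if $N\equiv3\pmod7$ and $N\ge4315$, then $B_{\bar N}$ ends after $2N+560$ terms; - if $N\equiv4\pmod7$ and $N\ge200$, then $B_{\bar N}$ ends after $2N+20$ terms; - if $N\equiv5\pmod7$ and $N\ge32478$, then $B_{\bar N}$ ends after $2N+4547$ terms; - if $N\equiv6\pmod7$ and $N\ge118$, then $B_{\bar N}$ ends after $2N+9$ terms.
   Context: The sequence ''ends after $m$ terms'' means $B_{\bar N}(1),\dots,B_{\bar N}(m)$ are defined and $B_{\bar N}(m+1)$ is undefined, which (since nonpositive indices have value $0$) happens exactly when some $B_{\bar N}(m+1-i)\le 0$ for $i\in\{1,2,3\}$, making a required index $\ge m+1$. *)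

(* Defs.v *)
From Stdlib Require Import Bool ZArith Lia.
Open Scope Z_scope.

(* A partial integer sequence indexed by all of Z; [None] means undefined. *)
Definition pseq := Z -> option Z.

(* The candidate for term n, computed from a sequence H that holds the terms of
   index <= n - 1 (an undefined B(n-1) makes B(n) undefined, so undefinedness
   propagates to all later terms). *)
Definition next (N : Z) (H : pseq) (n : Z) : option Z :=
  if n <=? N then Some n else
  match H (n - 1), H (n - 2), H (n - 3) with
  | Some a, Some b, Some c =>
      if (n - a <=? n - 1) && (n - b <=? n - 1) && (n - c <=? n - 1) then
        match H (n - a), H (n - b), H (n - c) with
        | Some x, Some y, Some z => Some (x + y + z)
        | _, _, _ => None
        end
      else None
  | _, _, _ => None
  end.

(* [history N m] holds the terms of index <= m and is [None] beyond m. *)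
Fixpoint history (N : Z) (m : nat) : pseq :=
  match m with
  | O => fun i => if i <=? 0 then Some 0 else None
  | S p => fun i =>
      if i =? Z.of_nat m then next N (history N p) (Z.of_nat m)
      else history N p i
  end.

Definition B (N : Z) : pseq := fun n => history N (Z.to_nat n) n.

Definition defined (s : pseq) (n : Z) : Prop := exists v, s n = Some v.

Definition ends_after (s : pseq) (m : Z) : Prop :=
  (forall n, 1 <= n <= m -> defined s n) /\ s (m + 1) = None.

Definition nu (N : Z) : Z :=
  match N mod 7 with
  | 0 => -1
  | 1 => -2
  | 2 => -2
  | 3 => -2
  | 4 => 2
  | 5 => 1
  | _ => 0
  end.

Lemma history_B (N : Z) (m : nat) (i : Z) :
  i <= Z.of_nat m -> history N m i = B N i.
Proof.
  unfold B; induction m as [|m IH]; intros Hi.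
  - now replace (Z.to_nat i) with O by lia.
  - destruct (Z.eq_dec i (Z.of_nat (S m))) as [->|Hne].
    + now rewrite Nat2Z.id.
    + cbn [history]; rewrite (proj2 (Z.eqb_neq _ _) Hne); apply IH; lia.
Qed.

Lemma B_nonpos (N n : Z) : n <= 0 -> B N n = Some 0.
Proof.
  intros Hn; unfold B; replace (Z.to_nat n) with O by lia; cbn [history].
  now rewrite (proj2 (Z.leb_le _ _) Hn).
Qed.

Lemma B_next (N n : Z) : 1 <= n -> B N n = next N (B N) n.
Proof.
  intros Hn; unfold B at 1.
  destruct (Z.to_nat n) as [|p] eqn:E; [lia|].
  assert (En : n = Z.of_nat (S p)) by lia.
  cbn [history]; rewrite <- En, Z.eqb_refl; unfold next.
  destruct (n <=? N); [reflexivity|].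
  rewrite !history_B by lia.
  destruct (B N (n - 1)) as [a|], (B N (n - 2)) as [b|], (B N (n - 3)) as [c|];
    try reflexivity.
  destruct (Z.leb_spec (n - a) (n - 1)), (Z.leb_spec (n - b) (n - 1)),
    (Z.leb_spec (n - c) (n - 1)); cbn [andb]; try reflexivity.
  now rewrite !history_B by lia.
Qed.

Lemma B_init (N n : Z) : 1 <= n <= N -> B N n = Some n.
Proof.
  intros Hn; rewrite B_next by lia; unfold next.
  now rewrite (proj2 (Z.leb_le n N)) by lia.
Qed.

(* Undefinedness propagates: a term is defined only if all previous ones are. *)
Lemma B_defined_prev (N n m : Z) : m <= n -> defined (B N) n -> defined (B N) m.
Proof.
  intros Hmn Hn.
  assert (step : forall i, defined (B N) i -> defined (B N) (i - 1)).
  { intros i [v Hv].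
    destruct (Z_le_gt_dec i 1) as [Hi|Hi].
    { exists 0; apply B_nonpos; lia. }
    destruct (Z_le_gt_dec i N) as [HN|HN].
    { exists (i - 1); apply B_init; lia. }
    rewrite B_next in Hv by lia; unfold next in Hv.
    rewrite (proj2 (Z.leb_gt i N)) in Hv by lia.
    destruct (B N (i - 1)) as [a|] eqn:Ea; [now exists a|discriminate]. }
  replace m with (n - Z.of_nat (Z.to_nat (n - m))) by lia.
  induction (Z.to_nat (n - m)) as [|p IH].
  - now rewrite Z.sub_0_r.
  - replace (n - Z.of_nat (S p)) with (n - Z.of_nat p - 1) by lia; auto.
Qed.

(* Main.v *)
(** Up to index [2 N + nu N] the claimed closed forms follow by induction: a term
    of the 7-periodic pattern only calls nonpositive indices, indices in the
    range [1..N+1], and the term seven places earlier.  Beyond that range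
    every term computed before the sequence ends is an affine function of [K],
    where [N = c + 7 K]; the residue [c] and the lower bound on [K] decide to which
    segment each index belongs, so that one symbolic evaluation per residue covers
    all admissible [N]. *)
Require Import Defs.
From Stdlib Require Import ZArith Bool List Lia FMapPositive.
Import ListNotations.
Open Scope Z_scope.

(** * One step of the recurrence *)

Lemma B_recurrence (N n a b c x y z : Z) : 0 <= N < n ->
  B N (n - 1) = Some a -> B N (n - 2) = Some b -> B N (n - 3) = Some c ->
  1 <= a -> 1 <= b -> 1 <= c ->
  B N (n - a) = Some x -> B N (n - b) = Some y -> B N (n - c) = Some z ->
  B N n = Some (x + y + z).
Proof.
  intros Hn Ha Hb Hc ? ? ? Hx Hy Hz.
  rewrite B_next by lia; unfold next.
  rewrite (proj2 (Z.leb_gt n N)), Ha, Hb, Hc by lia.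
  rewrite !(proj2 (Z.leb_le _ _)) by lia; cbn [andb].
  now rewrite Hx, Hy, Hz.
Qed.

Lemma B_undefined (N n a b c : Z) : 0 <= N < n ->
  B N (n - 1) = Some a -> B N (n - 2) = Some b -> B N (n - 3) = Some c ->
  a <= 0 \/ b <= 0 \/ c <= 0 -> B N n = None.
Proof.
  intros Hn Ha Hb Hc H.
  rewrite B_next by lia; unfold next.
  rewrite (proj2 (Z.leb_gt n N)), Ha, Hb, Hc by lia.
  destruct (Z.leb_spec (n - a) (n - 1)), (Z.leb_spec (n - b) (n - 1)),
    (Z.leb_spec (n - c) (n - 1)); cbn [andb]; reflexivity || lia.
Qed.

(** * Symbolic evaluation *)

(* [(a, b)] stands for the affine function [K => a + b * K]. *)
Definition form : Type := Z * Z.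

Definition eval (K : Z) (f : form) : Z := fst f + snd f * K.

Definition fadd (f g : form) : form := (fst f + fst g, snd f + snd g).

Definition fsub (f g : form) : form := (fst f - fst g, snd f - snd g).

Definition shift (f : form) (a : Z) : form := (fst f + a, snd f).

Definition fscale (m : Z) (f : form) : form := (m * fst f, m * snd f).

Lemma eval_fadd (K : Z) (f g : form) : eval K (fadd f g) = eval K f + eval K g.
Proof. unfold eval; cbn; ring. Qed.

Lemma eval_fsub (K : Z) (f g : form) : eval K (fsub f g) = eval K f - eval K g.
Proof. unfold eval; cbn; ring. Qed.

Lemma eval_shift (K : Z) (f : form) (a : Z) : eval K (shift f a) = eval K f + a.
Proof. unfold eval; cbn; ring. Qed.

Lemma eval_fscale (K m : Z) (f : form) : eval K (fscale m f) = m * eval K f.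
Proof. unfold eval; cbn; ring. Qed.

(* Sufficient, not necessary, for [f <= g] at all [K >= K0]. *)
Definition fle (K0 : Z) (f g : form) : bool :=
  (snd f <=? snd g) && (fst f + snd f * K0 <=? fst g + snd g * K0).

Lemma fleP (K0 K : Z) (f g : form) :
  K0 <= K -> fle K0 f g = true -> eval K f <= eval K g.
Proof.
  unfold fle, eval; intros HK H; apply andb_prop in H as [H1 H2].
  apply Z.leb_le in H1, H2.
  assert (snd f * (K - K0) <= snd g * (K - K0))
    by (apply Z.mul_le_mono_nonneg_r; lia).
  lia.
Qed.

(** Index and value are forms in the same [K]. Here [None] only means that no value is claimed; it
    does not say that the term is undefined. *)
Definition oracle : Type := form -> option form.

Definition sound (N K : Z) (o : oracle) : Prop :=
  forall f g, o f = Some g -> B N (eval K f) = Some (eval K g).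

Definition orelse (o1 o2 : oracle) : oracle :=
  fun f => match o1 f with Some g => Some g | None => o2 f end.

Lemma orelse_sound (N K : Z) (o1 o2 : oracle) :
  sound N K o1 -> sound N K o2 -> sound N K (orelse o1 o2).
Proof.
  unfold orelse; intros H1 H2 f g H; destruct (o1 f) eqn:E; auto.
  apply H1; congruence.
Qed.

(** Each case is decided uniformly for all [K >= K0]; an index that [fle] cannot place in one of the
    two segments gets no answer. *)
Definition initial (K0 : Z) (FN : form) : oracle :=
  fun f =>
    if fle K0 f (0, 0) then Some (0, 0)
    else if fle K0 (1, 0) f && fle K0 f FN then Some f else None.

Lemma initial_sound (K0 K : Z) (FN : form) :
  K0 <= K -> sound (eval K FN) K (initial K0 FN).
Proof.
  unfold initial; intros HK f g.
  destruct (fle K0 f (0, 0)) eqn:E0.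
  - intros [= <-]; apply (fleP _ _ _ _ HK) in E0.
    rewrite B_nonpos by exact E0; reflexivity.
  - destruct (fle K0 (1, 0) f && fle K0 f FN) eqn:E1; [intros [= <-]|discriminate].
    apply andb_prop in E1 as [E1 E2].
    apply (fleP _ _ _ _ HK) in E1, E2; apply B_init; split; [|exact E2].
    unfold eval in E1; cbn in E1; unfold eval; lia.
Qed.

Definition store : Type := PositiveMap.t form.

(** Terms computed just after [base] differ from it in index by a positive constant, which serves as
    the key. An index with another slope in [K] gets no answer here. *)
Definition table (base : form) (t : store) : oracle :=
  fun f =>
    let g := fsub f base in
    if snd g =? 0 then
      match fst g with Zpos p => PositiveMap.find p t | _ => None end
    else None.

Definition store_sound (N K : Z) (base : form) (t : store) : Prop :=
  forall p g, PositiveMap.find p t = Some g ->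
  B N (eval K base + Zpos p) = Some (eval K g).

Lemma table_sound (N K : Z) (base : form) (t : store) :
  store_sound N K base t -> sound N K (table base t).
Proof.
  unfold table; cbn; intros Ht f g.
  destruct (Z.eqb_spec (snd f - snd base) 0) as [E|]; [|discriminate].
  destruct (fst f - fst base) as [|p|] eqn:E'; try discriminate; intros H.
  rewrite <- (Ht p g H); f_equal; unfold eval.
  replace (snd f) with (snd base) by lia; lia.
Qed.

Lemma store_sound_empty (N K : Z) (base : form) :
  store_sound N K base (PositiveMap.empty form).
Proof. intros p g H; rewrite PositiveMap.gempty in H; discriminate. Qed.

Definition step (K0 : Z) (o : oracle) (n : form) : option form :=
  match o (shift n (-1)), o (shift n (-2)), o (shift n (-3)) with
  | Some a, Some b, Some c =>
      if fle K0 (1, 0) a && fle K0 (1, 0) b && fle K0 (1, 0) c then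
        match o (fsub n a), o (fsub n b), o (fsub n c) with
        | Some x, Some y, Some z => Some (fadd (fadd x y) z)
        | _, _, _ => None
        end
      else None
  | _, _, _ => None
  end.

Lemma step_sound (N K0 K : Z) (o : oracle) (n s : form) :
  K0 <= K -> sound N K o -> 0 <= N < eval K n ->
  step K0 o n = Some s -> B N (eval K n) = Some (eval K s).
Proof.
  unfold step; intros HK Ho HN.
  destruct (o (shift n (-1))) as [a|] eqn:Ea; [|discriminate].
  destruct (o (shift n (-2))) as [b|] eqn:Eb; [|discriminate].
  destruct (o (shift n (-3))) as [c|] eqn:Ec; [|discriminate].
  destruct (_ && _) eqn:E1; [|discriminate].
  destruct (o (fsub n a)) as [x|] eqn:Ex; [|discriminate].
  destruct (o (fsub n b)) as [y|] eqn:Ey; [|discriminate].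
  destruct (o (fsub n c)) as [z|] eqn:Ez; [intros [= <-]|discriminate].
  apply andb_prop in E1 as [E1 Hc]; apply andb_prop in E1 as [Ha Hb].
  apply (fleP _ _ _ _ HK) in Ha, Hb, Hc.
  apply Ho in Ea, Eb, Ec, Ex, Ey, Ez.
  rewrite eval_shift in Ea, Eb, Ec; rewrite eval_fsub in Ex, Ey, Ez.
  rewrite !eval_fadd.
  eapply B_recurrence; eauto.
Qed.

Fixpoint extend (K0 : Z) (o : oracle) (base : form) (fuel : nat) (j : positive)
    (t : store) : option store :=
  match fuel with
  | O => Some t
  | S fuel =>
      match step K0 (orelse o (table base t)) (shift base (Zpos j)) with
      | Some s => extend K0 o base fuel (Pos.succ j) (PositiveMap.add j s t)
      | None => None
      end
  end.

(** Each new entry is certified by [step_sound], and absent entries claim nothing, so soundness is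
    preserved whatever [j] and [t] are. *)
Lemma extend_sound (N K0 K : Z) (o : oracle) (base : form) :
  K0 <= K -> sound N K o -> 0 <= N <= eval K base ->
  forall fuel j t t', store_sound N K base t ->
  extend K0 o base fuel j t = Some t' -> store_sound N K base t'.
Proof.
  intros HK Ho HN fuel; induction fuel as [|fuel IH]; cbn [extend]; intros j t t' Ht.
  - now intros [= <-].
  - destruct (step _ _ _) as [s|] eqn:E; [|discriminate].
    apply IH; intros p g.
    destruct (Pos.eq_dec p j) as [->|Hne].
    + rewrite PositiveMap.gss; intros [= <-].
      apply (step_sound N K0 K) in E; auto using orelse_sound, table_sound;
        rewrite eval_shift in *; [exact E|lia].
    + rewrite PositiveMap.gso by exact Hne; apply Ht.
Qed.

Definition stops (K0 : Z) (o : oracle) (n : form) : bool :=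
  match o (shift n (-1)), o (shift n (-2)), o (shift n (-3)) with
  | Some a, Some b, Some c =>
      fle K0 a (0, 0) || fle K0 b (0, 0) || fle K0 c (0, 0)
  | _, _, _ => false
  end.

(** A nonpositive predecessor asks for an index not yet computed. The value found just before also
    shows that the last term exists, the other half of [ends_after]. *)
Lemma stops_sound (N K0 K : Z) (o : oracle) (n : form) :
  K0 <= K -> sound N K o -> 0 <= N < eval K n -> stops K0 o n = true ->
  defined (B N) (eval K n - 1) /\ B N (eval K n) = None.
Proof.
  unfold stops; intros HK Ho HN.
  destruct (o (shift n (-1))) as [a|] eqn:Ea; [|discriminate].
  destruct (o (shift n (-2))) as [b|] eqn:Eb; [|discriminate].
  destruct (o (shift n (-3))) as [c|] eqn:Ec; [|discriminate].
  apply Ho in Ea, Eb, Ec; rewrite eval_shift in Ea, Eb, Ec.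
  intros H; split; [eexists; exact Ea|].
  eapply B_undefined; eauto.
  apply orb_prop in H as [H|H]; [apply orb_prop in H as [H|H]|];
    apply (fleP _ _ _ _ HK) in H; unfold eval at 2 in H; cbn in H; auto.
Qed.

(** * The periodic range *)

Definition periodic (N k r : Z) : Z :=
  match r with
  | 0 => 7 * k + 2
  | 1 => N + 7 * k + 2
  | 2 => N + 7 * k + 4
  | 3 => 7
  | 4 => 2 * N + 2 * k + 45
  | 5 => 2 * N + k - 7
  | _ => N - 2
  end.

Definition fperiodic (FN k : form) (r : Z) : form :=
  match r with
  | 0 => shift (fscale 7 k) 2
  | 1 => shift (fadd FN (fscale 7 k)) 2
  | 2 => shift (fadd FN (fscale 7 k)) 4
  | 3 => (7, 0)
  | 4 => shift (fadd (fscale 2 FN) (fscale 2 k)) 45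
  | 5 => shift (fadd (fscale 2 FN) k) (-7)
  | _ => shift FN (-2)
  end.

Lemma eval_fperiodic (K : Z) (FN k : form) (r : Z) : 0 <= r <= 6 ->
  eval K (fperiodic FN k r) = periodic (eval K FN) (eval K k) r.
Proof.
  intros Hr.
  assert (r = 0 \/ r = 1 \/ r = 2 \/ r = 3 \/ r = 4 \/ r = 5 \/ r = 6)
    as [->|[->|[->|[->|[->|[->| ->]]]]]] by lia; cbn [fperiodic periodic];
    rewrite ?eval_shift, ?eval_fadd, ?eval_fscale; unfold eval; cbn [fst snd]; ring.
Qed.

(** The 73 terms after index [N] are 66 transient ones and the first full period, at offsets 67 to
    73. Comparison by [fle] in both directions serves as an equality test. *)
Definition starts_periodic (K0 : Z) (FN : form) (js : list Z) : bool :=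
  match extend K0 (initial K0 FN) FN 73 1 (PositiveMap.empty form) with
  | Some t =>
      forallb (fun j =>
        match table FN t (shift FN j) with
        | Some f =>
            let g := fperiodic FN (j / 7, 0) (j mod 7) in fle K0 f g && fle K0 g f
        | None => false
        end) js
  | None => false
  end.

Lemma starts_periodic_sound (K0 K : Z) (FN : form) (js : list Z) (k r : Z) :
  K0 <= K -> 0 <= eval K FN -> starts_periodic K0 FN js = true ->
  0 <= r <= 6 -> In (7 * k + r) js ->
  B (eval K FN) (eval K FN + (7 * k + r)) = Some (periodic (eval K FN) k r).
Proof.
  unfold starts_periodic; intros HK HN H Hr Hj.
  destruct (extend _ _ _ _ _ _) as [t|] eqn:Et; [|discriminate].
  apply (extend_sound (eval K FN) K0 K) in Et;
    auto using initial_sound, store_sound_empty; [|lia].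
  apply table_sound in Et.
  rewrite forallb_forall in H; specialize (H _ Hj); cbv beta in H.
  destruct (table FN t (shift FN _)) as [f|] eqn:Ef; [|discriminate].
  apply Et in Ef; rewrite eval_shift in Ef; rewrite Ef; f_equal.
  cbv zeta in H; apply andb_prop in H as [H1 H2].
  replace ((7 * k + r) / 7) with k in * by (Z.to_euclidean_division_equations; lia).
  replace ((7 * k + r) mod 7) with r in *
    by (Z.to_euclidean_division_equations; lia).
  apply (fleP _ _ _ _ HK) in H1, H2.
  rewrite eval_fperiodic in H1, H2 by lia.
  replace (eval K (k, 0)) with k in * by (unfold eval; cbn [fst snd]; lia).
  lia.
Qed.

(** Linear form of the case distinction, usable by [lia]. *)
Lemma nu_spec (N : Z) :
  exists q, (N = 7 * q /\ nu N = -1) \/ (N = 7 * q + 1 /\ nu N = -2) \/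
    (N = 7 * q + 2 /\ nu N = -2) \/ (N = 7 * q + 3 /\ nu N = -2) \/
    (N = 7 * q + 4 /\ nu N = 2) \/ (N = 7 * q + 5 /\ nu N = 1) \/
    (N = 7 * q + 6 /\ nu N = 0).
Proof.
  exists (N / 7); unfold nu.
  pose proof (Z.div_mod N 7 ltac:(lia)) as E.
  pose proof (Z.mod_pos_bound N 7 ltac:(lia)) as Hb.
  set (s := N mod 7) in *.
  assert (s = 0 \/ s = 1 \/ s = 2 \/ s = 3 \/ s = 4 \/ s = 5 \/ s = 6)
    as H by lia.
  repeat (destruct H as [H|H]; [rewrite H in *; lia|]); rewrite H in *; lia.
Qed.

Lemma B_periodic_start (N k r : Z) :
  72 <= N -> 0 <= r <= 6 -> 67 <= 7 * k + r <= 73 -> 7 * k + r <= N + nu N ->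
  B N (N + (7 * k + r)) = Some (periodic N k r).
Proof.
  intros HN Hr Hj Hnu.
  (* For 72 and 73 the range ends at offsets 70 and 71, inside the first period, so these are
     computed as constants; from 74 on, one run with [K = N] covers the whole period. *)
  assert (N = 72 \/ N = 73 \/ 74 <= N) as [->|[->|HN']] by lia.
  - change (nu 72) with (-2) in Hnu.
    apply (starts_periodic_sound 0 0 (72, 0) [67; 68; 69; 70]);
      [lia|cbn; lia|reflexivity|exact Hr|cbn [In]; lia].
  - change (nu 73) with (-2) in Hnu.
    apply (starts_periodic_sound 0 0 (73, 0) [67; 68; 69; 70; 71]);
      [lia|cbn; lia|reflexivity|exact Hr|cbn [In]; lia].
  - replace N with (eval N (0, 1)) by (unfold eval; cbn [fst snd]; lia).
    apply (starts_periodic_sound 74 N (0, 1) [67; 68; 69; 70; 71; 72; 73]);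
      [lia|unfold eval; cbn [fst snd]; lia|reflexivity|exact Hr|cbn [In]; lia].
Qed.

(** Column 3 of the pattern always calls index [N + 1], since [N + 7k + 3 - (7k + 2) = N + 1]; its
    constant 7 is [0 + 1 + 6]. *)
Lemma B_succ_N (N : Z) : 3 <= N -> B N (N + 1) = Some 6.
Proof.
  intros HN; change 6 with (1 + 2 + 3).
  apply (B_recurrence N _ N (N - 1) (N - 2)); try lia;
    rewrite B_init by lia; f_equal; lia.
Qed.

(** The binding constraint comes from columns 0, 1 and 2, which call indices [7k + 2], [7k + 3] and
    [7k + 4] and need them to be at most [N]. In every residue class, [2N + nu N + 1] is the first
    place where this fails. *)
Lemma B_periodic (N k r : Z) :
  72 <= N -> 0 <= r <= 6 -> 67 <= 7 * k + r <= N + nu N ->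
  B N (N + (7 * k + r)) = Some (periodic N k r).
Proof.
  intros HN Hr.
  remember (7 * k + r) as m eqn:Em; revert k r Hr Em.
  induction m as [m IH] using (well_founded_induction (Z.lt_wf 67)).
  intros k r Hr -> Hm.
  (* The base window has length 7, so beyond it the offset seven places back is still at least
     67. *)
  destruct (Z_le_gt_dec (7 * k + r) 73) as [H73|H73].
  { apply B_periodic_start; lia. }
  assert (prev : forall k' r' n, n = N + (7 * k' + r') -> 0 <= r' <= 6 ->
    67 <= 7 * k' + r' < 7 * k + r -> B N n = Some (periodic N k' r')).
  { intros k' r' n -> Hr' Hm'; apply (IH (7 * k' + r')); lia. }
  assert (low : forall n, n <= 0 -> B N n = Some 0) by (intros; now apply B_nonpos).
  assert (init : forall n, 1 <= n <= N -> B N n = Some n)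
    by (intros; now apply B_init).
  destruct (nu_spec N) as [q Hq].
  assert (r = 0 \/ r = 1 \/ r = 2 \/ r = 3 \/ r = 4 \/ r = 5 \/ r = 6)
    as [->|[->|[->|[->|[->|[->| ->]]]]]] by lia; cbn [periodic].
  - replace (7 * k + 2) with (7 * k + 2 + 0 + 0) by lia.
    eapply B_recurrence; [lia|apply (prev (k - 1) 6)|apply (prev (k - 1) 5)
      |apply (prev (k - 1) 4)|..]; cbn [periodic]; try lia.
    + rewrite init; [f_equal|]; lia.
    + apply low; lia.
    + apply low; lia.
  - replace (N + 7 * k + 2) with ((N - 1) + (7 * k + 3) + 0) by lia.
    eapply B_recurrence; [lia|apply (prev k 0)|apply (prev (k - 1) 6)
      |apply (prev (k - 1) 5)|..]; cbn [periodic]; try lia.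
    + rewrite init; [f_equal|]; lia.
    + rewrite init; [f_equal|]; lia.
    + apply low; lia.
  - replace (N + 7 * k + 4) with (0 + N + (7 * k + 4)) by lia.
    eapply B_recurrence; [lia|apply (prev k 1)|apply (prev k 0)
      |apply (prev (k - 1) 6)|..]; cbn [periodic]; try lia.
    + apply low; lia.
    + rewrite init; [f_equal|]; lia.
    + rewrite init; [f_equal|]; lia.
  - replace (Some 7) with (Some (0 + 1 + 6)) by reflexivity.
    eapply B_recurrence; [lia|apply (prev k 2)|apply (prev k 1)|apply (prev k 0)|..];
      cbn [periodic]; try lia.
    + apply low; lia.
    + rewrite init; [f_equal|]; lia.
    + rewrite <- (B_succ_N N) by lia; f_equal; lia.
  (* In columns 4, 5 and 6 the value 7 of column 3 calls the same column one period back; the other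
     two calls add 2, 1 and 0 respectively, the increment per period. *)
  - replace (2 * N + 2 * k + 45) with ((2 * N + 2 * (k - 1) + 45) + 0 + 2) by lia.
    eapply B_recurrence; [lia|apply (prev k 3)|apply (prev k 2)|apply (prev k 1)|..];
      cbn [periodic]; try lia.
    + apply (prev (k - 1) 4); lia.
    + apply low; lia.
    + rewrite init; [f_equal|]; lia.
  - replace (2 * N + k - 7) with (0 + (2 * N + (k - 1) - 7) + 1) by lia.
    eapply B_recurrence; [lia|apply (prev k 4)|apply (prev k 3)|apply (prev k 2)|..];
      cbn [periodic]; try lia.
    + apply low; lia.
    + apply (prev (k - 1) 5); lia.
    + rewrite init; [f_equal|]; lia.
  - replace (N - 2) with (0 + 0 + (N - 2)) by lia.
    eapply B_recurrence; [lia|apply (prev k 5)|apply (prev k 4)|apply (prev k 3)|..];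
      cbn [periodic]; try lia.
    + apply low; lia.
    + apply low; lia.
    + apply (prev (k - 1) 6); lia.
Qed.

(** * The end of the sequence *)

(** If 7 divides the slope of the offset, dividing both coefficients by 7 makes the period number a
    form in [K] and the column a constant. *)
Definition middle (K0 : Z) (FN last : form) : oracle :=
  fun f =>
    let g := fsub f FN in
    if fle K0 (67, 0) g && fle K0 f last && (snd g mod 7 =? 0)
    then Some (fperiodic FN (fst g / 7, snd g / 7) (fst g mod 7)) else None.

Lemma middle_sound (K0 K : Z) (FN last : form) :
  K0 <= K -> 72 <= eval K FN -> eval K last = 2 * eval K FN + nu (eval K FN) ->
  sound (eval K FN) K (middle K0 FN last).
Proof.
  unfold middle; intros HK HN Hl f g.
  destruct (_ && _) eqn:E; [intros [= <-]|discriminate].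
  apply andb_prop in E as [E E3]; apply andb_prop in E as [E1 E2].
  apply (fleP _ _ _ _ HK) in E1, E2; apply Z.eqb_eq in E3.
  change (eval K (67, 0)) with 67 in E1.
  pose proof (eval_fsub K f FN) as E; rewrite E in E1.
  change (fst f - fst FN) with (fst (fsub f FN)).
  change (snd f - snd FN) with (snd (fsub f FN)).
  set (h := fsub f FN) in *.
  pose proof (Z.mod_pos_bound (fst h) 7 ltac:(lia)) as Hr.
  rewrite eval_fperiodic by lia.
  assert (E' : eval K h = 7 * eval K (fst h / 7, snd h / 7) + fst h mod 7).
  { unfold eval; cbn [fst snd].
    pose proof (Z.div_mod (fst h) 7 ltac:(lia)).
    pose proof (Z.div_mod (snd h) 7 ltac:(lia)).
    nia. }
  rewrite <- B_periodic by lia; f_equal; lia.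
Qed.

(** The known terms are glued from four segments: the initial values, the 66 transient terms, the
    periodic range up to [2N + v], and the [m - v] terms from there to [2N + m]. *)
Definition ends_check (K0 : Z) (FN : form) (v m : Z) : bool :=
  let o1 := initial K0 FN in
  match extend K0 o1 FN 66 1 (PositiveMap.empty form) with
  | Some t1 =>
      let last := shift (fscale 2 FN) v in
      let o2 := orelse o1 (orelse (table FN t1) (middle K0 FN last)) in
      match extend K0 o2 last (Z.to_nat (m - v)) 1 (PositiveMap.empty form) with
      | Some t2 =>
          stops K0 (orelse o2 (table last t2)) (shift (fscale 2 FN) (m + 1))
      | None => false
      end
  | None => false
  end.

Lemma ends_check_sound (K0 K : Z) (FN : form) (N v m : Z) :
  K0 <= K -> 72 <= N -> N = eval K FN -> nu N = v -> 0 <= m ->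
  ends_check K0 FN v m = true -> ends_after (B N) (2 * N + m).
Proof.
  unfold ends_check; intros HK HN EN Hv Hm.
  assert (S1 : sound N K (initial K0 FN)) by (subst N; now apply initial_sound).
  destruct (extend _ _ FN _ _ _) as [t1|] eqn:E1; [|discriminate].
  apply (extend_sound N K0 K) in E1; auto using store_sound_empty; [|lia].
  set (last := shift _ v); set (o2 := orelse _ (orelse _ _)).
  assert (El : eval K last = 2 * N + v)
    by (subst last N; now rewrite eval_shift, eval_fscale).
  assert (S2 : sound N K o2).
  { apply orelse_sound; [exact S1|apply orelse_sound].
    - now apply table_sound.
    - subst N; apply middle_sound; lia. }
  destruct (nu_spec N) as [q Hq].
  destruct (extend _ _ last _ _ _) as [t2|] eqn:E2; [|discriminate].
  apply (extend_sound N K0 K) in E2; auto using store_sound_empty; [|lia].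
  intros H; apply (stops_sound N K0 K) in H;
    auto using orelse_sound, table_sound;
    rewrite eval_shift, eval_fscale, <- EN in *; [|lia].
  destruct H as [Hd He]; split.
  (* Definedness of term [2N + m] alone suffices, as it propagates downwards. *)
  - intros n Hn; apply (B_defined_prev N (2 * N + (m + 1) - 1)); [lia|exact Hd].
  - now rewrite <- Z.add_assoc.
Qed.

(** Here [K = N / 7]. As [N] and [7 * K0 + c] agree modulo 7, the bound with slack 6 still forces
    [K0 <= K], and [11 <= K0] gives [72 <= N]. *)
Lemma ends_after_residue (c K0 v m N : Z) :
  0 <= c <= 6 -> 11 <= K0 -> nu c = v -> 0 <= m ->
  ends_check K0 (c, 7) v m = true ->
  N mod 7 = c -> 7 * K0 + c <= N + 6 -> ends_after (B N) (2 * N + m).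
Proof.
  intros Hc HK Hv Hm H Hmod HN.
  pose proof (Z.div_mod N 7 ltac:(lia)) as E.
  apply (ends_check_sound K0 (N / 7) (c, 7) N v m); try assumption; try lia.
  - unfold eval; cbn [fst snd]; lia.
  - rewrite <- Hv; unfold nu; rewrite Hmod, Z.mod_small by lia; reflexivity.
Qed.

Theorem theorem2 (N : Z) (hN : 72 <= N) :
  (forall n k r : Z,
     N + 67 <= n <= 2 * N + nu N ->
     n = N + 7 * k + r -> 0 < k -> 0 <= r <= 6 ->
     defined (B N) n /\
     (r = 0 -> B N n = Some (7 * k + 2)) /\
     (r = 1 -> B N n = Some (N + 7 * k + 2)) /\
     (r = 2 -> B N n = Some (N + 7 * k + 4)) /\
     (r = 3 -> B N n = Some 7) /\
     (r = 4 -> B N n = Some (2 * N + 2 * k + 45)) /\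
     (r = 5 -> B N n = Some (2 * N + k - 7)) /\
     (r = 6 -> B N n = Some (N - 2))) /\
  (N mod 7 = 0 -> 196 <= N -> ends_after (B N) (2 * N + 27)) /\
  (N mod 7 = 1 -> 2087 <= N -> ends_after (B N) (2 * N + 254)) /\
  (N mod 7 = 2 -> 3201 <= N -> ends_after (B N) (2 * N + 524)) /\
  (N mod 7 = 3 -> 4315 <= N -> ends_after (B N) (2 * N + 560)) /\
  (N mod 7 = 4 -> 200 <= N -> ends_after (B N) (2 * N + 20)) /\
  (N mod 7 = 5 -> 32478 <= N -> ends_after (B N) (2 * N + 4547)) /\
  (N mod 7 = 6 -> 118 <= N -> ends_after (B N) (2 * N + 9)).
Proof.
  split.
  { intros n k r Hn -> _ Hr.
    rewrite <- Z.add_assoc in *.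
    assert (E := B_periodic N k r hN Hr ltac:(lia)).
    split; [eexists; exact E|].
    repeat apply conj; intros ->; exact E. }
  repeat apply conj; intros Hmod HN.
  (* In each case [K0] is the stated lower bound on [N] minus the residue, divided by 7; for
     instance [2087 = 7 * 298 + 1]. *)
  - apply (ends_after_residue 0 28 (-1)); try lia; now vm_compute.
  - apply (ends_after_residue 1 298 (-2)); try lia; now vm_compute.
  - apply (ends_after_residue 2 457 (-2)); try lia; now vm_compute.
  - apply (ends_after_residue 3 616 (-2)); try lia; now vm_compute.
  - apply (ends_after_residue 4 28 2); try lia; now vm_compute.
  - apply (ends_after_residue 5 4639 1); try lia; now vm_compute.
  - apply (ends_after_residue 6 16 0); try lia; now vm_compute.
Qed.
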